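(* For every integer $q\ge 3$ there is a constant $C_q>0$ (depending at most on $q$, not on $n$ or $\delta$) such that for every integer $n\ge 2$, every $\delta>0$, and every $q$-LCS $\mathcal S$ on $[n]$ with error-tolerance $\delta$, $$\mathrm{rank}(\mathcal S)\le C_q\,\delta^{-\frac{1}{q-1}}\, n^{\frac{q-2}{q-1}}\log_2 n .$$
   Context: A spanoid $\mathcal S$ on $[n]=\{1,\dots,n\}$ is a family of pairs $(S,i)$ with $S\subseteq[n]$, $i\in[n]$ (rules, written $S\to i$). For $T\subseteq[n]$ and $i\in[n]$ write $T\models i$ if there is a sequence $T=T_0,T_1,\dots,T_r$ ($r\ge 0$) with $i\in T_r$ such that for each $j\in[r]$, $T_j=T_{j-1}\cup\{i_j\}$ for some $i_j\in[n]$ for which there is $S\subseteq T_{j-1}$ with $(S,i_j)\in\mathcal S$. $\mathrm{span}(T)=\{i: T\models i\}$, and $\mathrm{rank}(\mathcal S)$ is the minimum size of $T\subseteq[n]$ with $\mathrm{span}(T)=[n]$. A spanoid $\mathcal S$ on $[n]$ is a $q$-LCS with error-tolerance $\delta$ if for every $i\in[n]$ there is a family $M_i$ of at least $\delta n$ pairwise disjoint $q$-element subsets of $[n]$ such that $(S,i)\in\mathcal S$ for every $S\in M_i$. *)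

(* Defs.v *)
From HB Require Import structures.
From mathcomp Require Import all_boot all_order all_algebra.
From mathcomp Require Import reals exp.

Set Implicit Arguments.
Unset Strict Implicit.
Unset Printing Implicit Defensive.

Import Order.TTheory GRing.Theory Num.Theory.

(* The ground set [n] = {1, ..., n} is represented by 'I_n = {0, ..., n-1};
   the pair (A, i) is the rule A -> i. *)
Definition spanoid (n : nat) : Type := {set {set 'I_n} * 'I_n}.

Definition derivation_step (n : nat) (S : spanoid n) : rel {set 'I_n} :=
  fun T T' =>
    [exists j : 'I_n, (T' == j |: T) &&
      [exists A : {set 'I_n}, (A \subset T) && ((A, j) \in S)]].

(* [connect] is the reflexive transitive closure, so this says that some
   finite derivation T = T_0, ..., T_r with r >= 0 has i \in T_r. *)
Definition entails (n : nat) (S : spanoid n) (T : {set 'I_n}) (i : 'I_n) :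
    bool :=
  [exists T' : {set 'I_n}, connect (derivation_step S) T T' && (i \in T')].

Definition span (n : nat) (S : spanoid n) (T : {set 'I_n}) : {set 'I_n} :=
  [set i | entails S T i].

Lemma span_setT (n : nat) (S : spanoid n) : span S [set: 'I_n] = [set: 'I_n].
Proof.
apply/setP=> i; rewrite !inE; apply/existsP; exists [set: 'I_n].
by rewrite connect0 inE.
Qed.

(* By [span_setT], the initial candidate [set: 'I_n] of the minimization
   satisfies its constraint, so the minimum is genuine. *)
Definition rank (n : nat) (S : spanoid n) : nat :=
  #|[arg min_(T < [set: 'I_n] | span S T == [set: 'I_n]) #|T| ]|.

Local Open Scope ring_scope.

Definition is_LCS (R : realType) (q n : nat) (delta : R) (S : spanoid n) :
    Prop :=
  forall i : 'I_n, exists M : {set {set 'I_n}},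
    [/\ delta * n%:R <= #|M|%:R,
        trivIset M,
        forall A : {set 'I_n}, A \in M -> #|A| = q
      & forall A : {set 'I_n}, A \in M -> (A, i) \in S].

Definition log2 (R : realType) (x : R) : R := ln x / ln 2.

(* Main.v *)
Require Import Defs.
From mathcomp Require Import all_boot all_order all_algebra.
From mathcomp Require Import reals exp.
From mathcomp Require Import ring lra zify.

Import Order.TTheory GRing.Theory Num.Theory.
Local Open Scope ring_scope.

(** Keep a pair (T, B) such that every point lies in the span of [b |: T] for
    some b in B, or already in the span of T; initially T is empty and B is
    everything. Let g v be such a b. With c about y = (delta n)^(1/(q-1)), add to
    T the at most 2/delta points b with at least delta n / 2 preimages under g,
    and a random set A of density 1/c. A remaining i in B has at least
    delta n / 2 disjoint rules avoiding g^-1(i), so with constant probability A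
    contains all but one point w of one of them; then i is spanned by g w,
    with g w <> i. In the preorder "j spans i modulo T" a constant
    fraction of B thus has another point of B below it, so B can be replaced by
    a set smaller by a constant factor. Each round costs O(n/y) points, and
    O(log n) rounds empty B. *)

(** * Derivations and closure properties of [span] *)

Section Span.
Context {n : nat} (S : spanoid n).
Implicit Types (T U A : {set 'I_n}) (i j : 'I_n).

Lemma connect_derivation_sub T T' :
  connect (derivation_step S) T T' -> T \subset T'.
Proof.
move=> /connectP[p pth ->] {T'}; elim: p T pth => //= T1 p IH T.
move=> /andP[/existsP[j /andP[/eqP-> _]] pth].
exact: subset_trans (subsetUr _ _) (IH _ pth).
Qed.

(** Every rule fired from [T] also fires from the larger [U]. A point already in [U] may be added
    again, since a derivation step need not enlarge the set. *)
Lemma connect_derivation_setU T T' U :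
  connect (derivation_step S) T T' -> T \subset U ->
  connect (derivation_step S) U (U :|: T').
Proof.
move=> /connectP[p pth ->] {T'}; elim: p T U pth => [|T1 p IH] T U /=.
  by move=> _ /setUidPl->; exact: connect0.
move=> /andP[/existsP[j /andP[/eqP-> /existsP[A /andP[sAT Aj]]]] pth] sTU.
have stepU : derivation_step S U (j |: U).
  apply/existsP; exists j; rewrite eqxx; apply/existsP; exists A.
  by rewrite Aj (subset_trans sAT sTU).
have := IH _ (j |: U) pth (setUS _ sTU).
have /setUidPr jl : [set j] \subset last (j |: T) p.
  rewrite sub1set; apply: (subsetP (connect_derivation_sub (j |: T) _ _)).
    by apply/connectP; exists p.
  exact: setU11.
have -> : j |: U :|: last (j |: T) p = U :|: last (j |: T) p.
  by rewrite (setUC [set j]) -setUA jl.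
by apply: connect_trans; exact: connect1.
Qed.

Lemma span_extensive T : T \subset Defs.span S T.
Proof.
by apply/subsetP=> i iT; rewrite inE; apply/existsP; exists T; rewrite connect0.
Qed.

(** [span] allows a separate derivation for each point; by monotonicity these can be run one after
    another. A single derivation is what lets a rule fire once all its premises are spanned. *)
Lemma span_sub_derivable T :
  exists2 T', connect (derivation_step S) T T' & Defs.span S T \subset T'.
Proof.
suff [T' TT' sub] : exists2 T', connect (derivation_step S) T T' &
    {subset enum (Defs.span S T) <= T'}.
  by exists T' => //; apply/subsetP=> i iT; apply: sub; rewrite mem_enum.
have : {subset enum (Defs.span S T) <= Defs.span S T} by move=> i; rewrite mem_enum.
elim: (enum _) => [|i s IH] sub; first by exists T.
have [|T1 TT1 sub1] := IH; first by move=> j js; apply: sub; rewrite inE js orbT.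
have := sub i (mem_head _ _); rewrite inE => /existsP[T2 /andP[TT2 iT2]].
have sTT1 := connect_derivation_sub _ _ TT1.
exists (T1 :|: T2).
  exact: connect_trans TT1 (connect_derivation_setU _ _ _ TT2 sTT1).
by move=> j; rewrite !inE => /predU1P[->|/sub1->//]; rewrite iT2 orbT.
Qed.

Lemma span_rule T A i : (A, i) \in S -> A \subset Defs.span S T -> i \in Defs.span S T.
Proof.
move=> Ai sAT; have [T' TT' sub] := span_sub_derivable T.
rewrite inE; apply/existsP; exists (i |: T'); rewrite setU11 andbT.
apply: connect_trans TT' (connect1 _); apply/existsP; exists i; rewrite eqxx.
by apply/existsP; exists A; rewrite Ai (subset_trans sAT sub).
Qed.

Lemma span_min T U : T \subset U ->
  (forall A j, (A, j) \in S -> A \subset U -> j \in U) -> Defs.span S T \subset U.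
Proof.
move=> sTU Ucl; apply/subsetP=> i; rewrite inE => /existsP[T' /andP[]].
move=> /connectP[p pth ->]; elim: p T sTU pth => [|T1 p IH] T sTU /=.
  by move=> _; apply: (subsetP sTU).
move=> /andP[/existsP[j /andP[/eqP-> /existsP[A /andP[sAT Aj]]]] pth].
apply: IH pth; rewrite subUset sTU sub1set andbT.
exact: Ucl Aj (subset_trans sAT sTU).
Qed.

Lemma span_subset T U : T \subset Defs.span S U -> Defs.span S T \subset Defs.span S U.
Proof. by move=> sTU; apply: span_min => // A j; exact: span_rule. Qed.

Lemma spanS T U : T \subset U -> Defs.span S T \subset Defs.span S U.
Proof. by move=> sTU; apply/span_subset/(subset_trans sTU)/span_extensive. Qed.

Lemma rank_le T : Defs.span S T = [set: 'I_n] -> (rank S <= #|T|)%N.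
Proof.
move=> spT; rewrite /rank; case: arg_minnP => [|T0 _]; first by rewrite span_setT.
by apply; apply/eqP.
Qed.

End Span.

(** * Small dominating sets in a finite preorder *)

(* Take a dominating set [D] of minimal size. A point of [D] with another point
   of [B] below it can be traded for that point, so the latter lies outside [D],
   and distinct points of [D] have distinct substitutes. *)
Lemma min_dominating_card (I : finType) (r : rel I) (B : {set I}) :
  reflexive r -> transitive r ->
  exists2 B' : {set I}, B' \subset B &
    (forall i, i \in B -> exists2 j, j \in B' & r j i) /\
    (2 * #|B'| <= #|B| + #|[set i in B | ~~ [exists j in B, (j != i) && r j i]]|)%N.
Proof.
move=> rr rt; pose dom (D : {set I}) :=
  (D \subset B) && [forall i in B, exists j in D, r j i].
have domB : dom B.
  by rewrite /dom subxx; apply/forall_inP=> i iB; apply/exists_inP; exists i.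
have domP D : dom D ->
    D \subset B /\ (forall i, i \in B -> exists2 j, j \in D & r j i).
  move=> /andP[sDB /forall_inP dD]; split=> // i /dD /exists_inP[j jD rji].
  by exists j.
case: (arg_minnP (fun D : {set I} => #|D|) domB) => D dD minD.
have [sDB dDP] := domP _ dD.
exists D => //; split=> //.
set bad := [set i in B | _].
pose s i := odflt i [pick j in B | (j != i) && r j i].
have sP i : i \in D :\: bad -> [/\ s i \in B, s i != i & r (s i) i].
  rewrite !inE => /andP[+ iD]; rewrite (subsetP sDB _ iD) /= negbK.
  move=> /exists_inP[j jB jP]; rewrite /s; case: pickP => [k /andP[kB /andP[]]//|].
  by move/(_ j); rewrite jB jP.
have replace (X : {set I}) x : X \subset D -> x \in B ->
    (forall i, i \in X -> r x i) -> (#|D| <= #|x |: (D :\: X)|)%N.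
  move=> sXD xB rxX; apply: minD; rewrite /dom subUset sub1set xB /=.
  rewrite (subset_trans (subsetDl _ _) sDB) /=.
  apply/forall_inP=> i /dDP[j jD rji].
  have [jX|jX] := boolP (j \in X).
    by apply/exists_inP; exists x; rewrite ?setU11 //; apply: rt rji; apply: rxX.
  by apply/exists_inP; exists j => //; rewrite !inE jX jD orbT.
have sND i : i \in D :\: bad -> s i \notin D.
  move=> iDb; have [sB si ri] := sP _ iDb; apply/negP=> sD.
  have iD : i \in D by move: iDb; rewrite inE => /andP[].
  have : (#|D| <= #|s i |: D :\ i|)%N.
    by apply: replace => // [|j /set1P->//]; rewrite sub1set.
  have -> : s i |: D :\ i = D :\ i.
    by apply/setUidPr; rewrite sub1set !inE si.
  by rewrite (cardsD1 i D) iD ltnn.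
have sI : {in D :\: bad &, injective s}.
  move=> i j iDb jDb eqs; apply/eqP/negP => /negP nij.
  have [iD jD] : i \in D /\ j \in D.
    by move: iDb jDb; rewrite !inE => /andP[_ ->] /andP[_ ->].
  have [sB _ ri] := sP _ iDb; have [_ _ rj] := sP _ jDb.
  have : (#|D| <= #|s i |: D :\: [set i; j]|)%N.
    apply: replace => // [|k /set2P[]-> //]; first by rewrite subUset !sub1set iD.
    by rewrite eqs.
  rewrite cardsU1 !inE (negPf (sND _ iDb)) andbF /= cardsD.
  have /setIidPr-> : [set i; j] \subset D by rewrite subUset !sub1set iD.
  have := subset_leq_card (_ : [set i; j] \subset D).
  rewrite subUset !sub1set iD jD cards2 nij => /(_ isT).
  by case: #|D| => [|[|k]] //= _; rewrite !subSS subn0 add1n ltnn.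
have : (#|D :\: bad| <= #|B :\: D|)%N.
  rewrite -(card_in_imset sI); apply/subset_leq_card/subsetP=> _ /imsetP[i iDb ->].
  by rewrite inE (sND _ iDb); case: (sP _ iDb).
rewrite !cardsD (setIidPr sDB) !leq_subLR.
have sDc : (#|D| <= #|B|)%N := subset_leq_card sDB.
have : (#|D :&: bad| <= #|bad|)%N by rewrite subset_leq_card // subsetIr.
move=> a1 a2; lia.
Qed.

(** * Counting random colourings, and sampling by them *)

Lemma double_count (X Y : finType) (r : X -> Y -> bool) :
  (\sum_(x : X) #|[set y | r x y]| = \sum_(y : Y) #|[set x | r x y]|)%N.
Proof.
have card_sum (Z : finType) (p : pred Z) : #|[set z | p z]| = (\sum_(z : Z) p z)%N.
  by rewrite -sum1_card big_mkcond; apply: eq_bigr => z _; rewrite inE; case: (p z).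
under eq_bigr do rewrite card_sum; rewrite exchange_big /=.
by apply: eq_bigr => y _; rewrite card_sum.
Qed.

Section RandomColouring.
Context {V : finType} {c : nat}.
Let F := {ffun V -> 'I_c.+1}.

Definition zeros (f : F) : {set V} := [set v | f v == ord0].

(* Exchanging two colourings on the complement of [D] is an involution of
   [F * F]; it carries [P x Q] onto [(P and Q) x F]. *)
Lemma card_independent (D : {set V}) (P Q : pred F) :
  (forall f g : F, {in D, f =1 g} -> P f = P g) ->
  (forall f g : F, {in ~: D, f =1 g} -> Q f = Q g) ->
  (#|[set f | P f]| * #|[set f | Q f]| = #|[set f | P f && Q f]| * #|{: F}|)%N.
Proof.
move=> Ploc Qloc.
pose mix (f g : F) : F := [ffun v => if v \in D then f v else g v].
pose swap p := (mix p.1 p.2, mix p.2 p.1).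
have swapK : involutive swap.
  by move=> [f g]; rewrite /swap /=; congr (_, _); apply/ffunP=> v; rewrite !ffunE /=; case: (v \in D).
rewrite -cardsT -!cardsX -[RHS](card_preimset _ (inv_inj swapK)).
apply: eq_card => -[f g]; rewrite !inE /= andbT; congr (_ && _).
  by apply: Ploc => v vD; rewrite ffunE vD.
by apply: Qloc => v; rewrite inE ffunE => /negPf->.
Qed.

(** Vanishing on [e] means being supported off [e], with free values there; a uniform colouring does
    so with probability [(c+1)^(-|e|)]. *)
Lemma card_sub_zeros (e : {set V}) :
  (#|[set f : F | e \subset zeros f]| * c.+1 ^ #|e| = #|{: F}|)%N.
Proof.
have -> : #|[set f : F | e \subset zeros f]| =
    #|pffun_on (ord0 : 'I_c.+1) (mem (~: e)) (@predT 'I_c.+1)|.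
  apply: eq_card => f; rewrite inE; apply/subsetP/pffun_onP => [ez|[sup _] v ve].
    split=> //; apply/subsetP=> v; rewrite !inE; apply: contra => /ez.
    by rewrite inE.
  rewrite inE; apply: contraTT ve => fv.
  by have := subsetP sup v fv; rewrite inE.
rewrite card_pffun_on card_ffun -(cardsC e) expnD mulnC card_ord.
by congr (_ * _ ^ _)%N; apply: eq_card.
Qed.

(** Disjoint sets give independent events, so all are avoided with probability [(1 - 1/K)^m], where
    [K = (c+1)^k] and [m = size s]. Denominators are cleared to stay in the naturals. *)
Lemma card_avoiding (k : nat) (s : seq {set V}) :
  pairwise (fun e e' : {set V} => [disjoint e & e']) s -> all (fun e : {set V} => #|e| == k) s ->
  (#|[set f : F | all (fun e : {set V} => ~~ (e \subset zeros f)) s]| *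
     (c.+1 ^ k) ^ size s = #|{: F}| * (c.+1 ^ k).-1 ^ size s)%N.
Proof.
elim: s => [_ _|e s IH] /=.
  by rewrite !muln1; apply: eq_card => f; rewrite !inE.
move=> /andP[/allP de /IH{}IH] /andP[/eqP ek /IH{}IH].
set K := (c.+1 ^ k)%N in IH *.
pose P (f : F) := e \subset zeros f.
pose Q (f : F) := all (fun e : {set V} => ~~ (e \subset zeros f)) s.
have eq_sub (D : {set V}) (f g : F) : {in D, f =1 g} ->
    (D \subset zeros f) = (D \subset zeros g).
  move=> fg; apply/subsetP/subsetP => sub v vD; have := sub v vD.
    by rewrite !inE fg.
  by rewrite !inE fg.
have := card_independent e P Q (fun f g => eq_sub e f g).
have Qloc (f g : F) : {in ~: e, f =1 g} -> Q f = Q g.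
  move=> fg; apply: eq_in_all => e' /de; rewrite disjoint_sym => dee'.
  congr (~~ _); apply: eq_sub => v ve'; apply: fg.
  by rewrite inE (disjointFr dee' ve').
move=> /(_ Qloc).
have := card_sub_zeros e; rewrite ek -/K -[[set f : F | e \subset _]]/[set f | P f].
have F0 : (0 < #|{: F}|)%N by rewrite card_ffun card_ord expn_gt0.
have K0 : (0 < K)%N by rewrite expn_gt0.
have -> : #|[set f : F | ~~ (e \subset zeros f) && Q f]| =
    (#|[set f | Q f]| - #|[set f | P f && Q f]|)%N.
  rewrite -(cardsID [set f | P f] [set f | Q f]).
  have -> : [set f | Q f] :&: [set f | P f] = [set f | P f && Q f].
    by apply/setP=> f; rewrite !inE andbC.
  by rewrite addKn; apply: eq_card => f; rewrite !inE.
move=> cardP indep; rewrite -cardP in indep.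
(* The total number of colourings is [K] times the number satisfying [P], so this nonzero factor
   cancels from the independence identity. *)
have {}indep : #|[set f | Q f]| = (#|[set f | P f && Q f]| * K)%N.
  apply/eqP; rewrite -(eqn_pmul2r (_ : 0 < #|[set f | P f]|)%N).
    by rewrite mulnC indep mulnA mulnAC.
  by move: F0; rewrite -cardP muln_gt0 => /andP[].
rewrite !expnS mulnA mulnBl -indep.
have -> : (#|[set f | Q f]| * K - #|[set f | Q f]| = #|[set f | Q f]| * K.-1)%N.
  by rewrite -subn1 mulnBr muln1.
by rewrite mulnAC IH mulnAC mulnA.
Qed.


(** A division-free form of [(1 - 1/K)^m <= 1/(1 + m/K)]. *)
Lemma bernoulli_pred (K m : nat) : (0 < K)%N -> (K.-1 ^ m * (K + m) <= K ^ m.+1)%N.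
Proof.
case: K => //= K _; elim: m => [|m IH]; first by rewrite addn0 mul1n.
rewrite expnSr -mulnA [(K.+1 ^ _)%N]expnSr.
apply: leq_trans (leq_mul IH (leqnn _)); rewrite -mulnA leq_mul2l; apply/orP; right.
nia.
Qed.

(** For [m >= K/2] the Bernoulli bound on the avoidance probability is at most
    [1/(1 + 1/2) = 2/3]. *)
Lemma card_avoiding_le (k : nat) (s : seq {set V}) :
  pairwise (fun e e' : {set V} => [disjoint e & e']) s -> all (fun e : {set V} => #|e| == k) s ->
  (c.+1 ^ k <= 2 * size s)%N ->
  (3 * #|[set f : F | all (fun e : {set V} => ~~ (e \subset zeros f)) s]| <= 2 * #|{: F}|)%N.
Proof.
move=> ds sk; have := card_avoiding k s ds sk.
set K := (c.+1 ^ k)%N; set m := size s; set N := #|[set f : F | _]|.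
have K0 : (0 < K)%N by rewrite expn_gt0.
move=> NE Km; have := bernoulli_pred K m K0.
have Km0 : (0 < K ^ m)%N by rewrite expn_gt0 K0.
rewrite expnS => bern.
have {}bern : (3 * K.-1 ^ m <= 2 * K ^ m)%N.
  rewrite -(leq_pmul2r K0); apply: leq_trans (_ : 2 * (K * K ^ m) <= _)%N; last by lia.
  apply: leq_trans (leq_mul (leqnn 2) bern).
  rewrite mulnAC mulnC [leqRHS]mulnCA leq_mul2l; apply/orP; right; lia.
rewrite -(leq_pmul2r Km0) -mulnA NE -mulnA mulnCA [leqRHS]mulnCA leq_mul2l bern.
by rewrite orbT.
Qed.

Lemma sum_card_zeros : (c.+1 * \sum_(f : F) #|zeros f| = #|V| * #|{: F}|)%N.
Proof.
have -> : (\sum_(f : F) #|zeros f| = \sum_(v : V) #|[set f : F | [set v] \subset zeros f]|)%N.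
  under [RHS]eq_bigr do under eq_finset do rewrite sub1set inE.
  by rewrite -double_count; apply: eq_bigr => f _; apply: eq_card => v; rewrite !inE.
rewrite big_distrr /= (eq_bigr (fun=> #|{: F}|)) ?sum_nat_const // => v _.
by rewrite -(card_sub_zeros [set v]) cards1 expn1 mulnC.
Qed.

End RandomColouring.

(** The zero set of a random colouring has mean size [|V|/(c+1)] and fails for at most [2/3] of [B]
    on average. Weighting the normalised failures by 6 and the normalised size by 1 gives mean at
    most [6 * 2/3 + 1 = 5], whence both constants. *)
Lemma sparse_sampling_set (I V : finType) (c k : nat) (B : {set I})
    (s : I -> seq {set V}) :
  (0 < #|V|)%N ->
  (forall i, i \in B -> pairwise (fun e e' : {set V} => [disjoint e & e']) (s i)) ->
  (forall i, i \in B -> all (fun e : {set V} => #|e| == k) (s i)) ->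
  (forall i, i \in B -> (c.+1 ^ k <= 2 * size (s i))%N) ->
  exists2 A : {set V}, (c.+1 * #|A| <= 5 * #|V|)%N &
    (6 * #|[set i in B | all (fun e : {set V} => ~~ (e \subset A)) (s i)]| <= 5 * #|B|)%N.
Proof.
move=> V0 ds sk sz.
pose bad (A : {set V}) := [set i in B | all (fun e : {set V} => ~~ (e \subset A)) (s i)].
have [->|Bn0] := eqVneq B set0.
  exists set0; rewrite ?cards0 ?muln0 //.
  by rewrite eq_card0 // => i; rewrite !inE.
have B0 : (0 < #|B|)%N by rewrite card_gt0.
pose F := {ffun V -> 'I_c.+1}.
have sum_bad : (3 * \sum_(f : F) #|bad (zeros f)| <= 2 * (#|B| * #|{: F}|))%N.
  have -> : (\sum_(f : F) #|bad (zeros f)| = \sum_(i in B)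
      #|[set f : F | all (fun e : {set V} => ~~ (e \subset zeros f)) (s i)]|)%N.
    rewrite double_count [RHS]big_mkcond; apply: eq_bigr => i _.
    have [iB|iB] := boolP (i \in B).
      by apply: eq_card => f; rewrite !inE.
    by apply: eq_card0 => f; rewrite inE.
  rewrite big_distrr /= mulnCA -sum_nat_const; apply: leq_sum => i iB.
  by apply: (card_avoiding_le k); [apply: ds|apply: sk|apply: sz].
(* Averaging this weight over all colourings controls both quantities at once. *)
pose weight (f : F) := (6 * #|V| * #|bad (zeros f)| + c.+1 * #|zeros f| * #|B|)%N.
have [f wf] : exists f : F, (weight f <= 5 * #|V| * #|B|)%N.
  apply/existsP; rewrite -[[exists _, _]]negbK negb_exists; apply/negP => /forallP big.
  have : (\sum_(f : F) (5 * #|V| * #|B|).+1 <= \sum_(f : F) weight f)%N.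
    by apply: leq_sum => f _; rewrite ltnNge; apply: big.
  rewrite sum_nat_const big_split /= -big_distrr /= -big_distrl -big_distrr /=.
  rewrite sum_card_zeros.
  have F0 : (0 < #|{: F}|)%N by rewrite card_ffun card_ord expn_gt0.
  rewrite leqNgt => /negP; apply.
  set X := (\sum_f _)%N in sum_bad *.
  rewrite (_ : 6 * #|V| * X = 2 * #|V| * (3 * X))%N; last by ring.
  have : (2 * #|V| * (3 * X) <= 2 * #|V| * (2 * (#|B| * #|{: F}|)))%N.
    by rewrite leq_mul2l sum_bad orbT.
  set y := (_ * (3 * X))%N; move: #|{: F}| F0 #|V| #|B| y => g g0 v b y {sum_bad}.
  move=> H; rewrite mulnS.
  have -> : (g * (5 * v * b) = 2 * v * (2 * (b * g)) + v * g * b)%N by ring.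
  by rewrite addnA ltn_add2r -add1n leq_add.
exists (zeros f).
  rewrite -(leq_pmul2r B0); apply: leq_trans wf; exact: leq_addl.
rewrite -(leq_pmul2l V0) mulnCA mulnA mulnCA mulnA; apply: leq_trans wf; exact: leq_addr.
Qed.

(** * One round of refinement *)

Definition dominates {n : nat} (S : spanoid n) (T B : {set 'I_n}) : Prop :=
  forall v, v \in Defs.span S T \/ exists2 b, b \in B & v \in Defs.span S (b |: T).

(** At most [5/6] of the light points fail the sampling, so the preorder bound leaves a fraction
    [(1 + 5/6)/2 = 11/12] of [B]. The two added terms pay for [heavy] and for the sample. *)
Lemma dominates_refine (R : realType) (k n c : nat) (delta : R) (S : spanoid n)
    (T B : {set 'I_n}) :
  (0 < n)%N -> 0 < delta -> is_LCS k.+1 delta S ->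
  (c.+1 ^ k)%:R <= delta * n%:R -> dominates S T B ->
  exists T' B' : {set 'I_n}, [/\ dominates S T' B', (12 * #|B'| <= 11 * #|B|)%N &
    #|T'|%:R <= #|T|%:R + (2 / delta + 5 * n%:R / c.+1%:R)].
Proof.
move=> n0 d0 lcs ck dom.
have n0R : 0 < n%:R :> R by rewrite ltr0n.
have [B0|] := eqVneq B set0.
  exists T, B; split=> //; first by rewrite B0 cards0.
  by rewrite lerDl addr_ge0 // divr_ge0 // ?mulr_ge0 // ltW.
move=> /set0Pn[b0 b0B].
(* For [v] already spanned by [T] any value in [B] will do, so [b0] serves as default and [g] is
   total. *)
have /fin_all_exists[g gP] v : exists b, b \in B /\ v \in Defs.span S (b |: T).
  have [vT|[b bB vb]] := dom v; last by exists b.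
  by exists b0; split=> //; apply: subsetP vT; apply/spanS/subsetUr.
pose fiber b := [set v | g v == b].
pose heavy := [set b | delta * n%:R / 2 <= #|fiber b|%:R].
have heavy_le : #|heavy|%:R <= 2 / delta.
  have : (\sum_(b in heavy) #|fiber b| <= n)%N.
    apply: leq_trans (_ : \sum_b #|fiber b| <= _)%N.
      by rewrite [leqRHS](bigID (mem heavy)) leq_addr.
    rewrite double_count (eq_bigr (fun=> 1%N)) ?sum1_card ?card_ord // => v _.
    by rewrite -(cards1 (g v)); apply: eq_card => b; rewrite !inE eq_sym.
  rewrite -(ler_nat R) natr_sum => le_n.
  have : \sum_(b in heavy) (delta * n%:R / 2) <= n%:R.
    by apply: le_trans le_n; apply: ler_sum => b; rewrite inE.
  rewrite sumr_const -mulr_natl => H.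
  rewrite ler_pdivlMr // -(ler_pM2r n0R); lra.
have /fin_all_exists[M MP] := lcs.
pose E i := [set e in M i | [forall v in e, g v != i]].
have card_E i : i \notin heavy -> (c.+1 ^ k <= 2 * #|E i|)%N.
  have [lcsM trM _ _] := MP i.
  rewrite inE -ltNge => light.
  (* A discarded rule meets the fiber of [i], and disjointness lets [pblock] recover the rule from
     the meeting point. *)
  have : (#|M i :\: E i| <= #|fiber i|)%N.
    apply: leq_trans (leq_imset_card (pblock (M i)) _).
    apply/subset_leq_card/subsetP => e; rewrite !inE => /andP[+ eM].
    rewrite eM /= => /forall_inPn[v ve]; rewrite negbK => gv.
    by apply/imsetP; exists v; rewrite ?inE // (def_pblock trM eM ve).
  rewrite cardsD (setIidPr _); last by apply/subsetP=> e; rewrite inE => /andP[].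
  rewrite leq_subLR -(ler_nat R) natrD => le_M.
  rewrite -(ler_nat R) natrM; lra.
pose w (e : {set 'I_n}) := odflt b0 [pick v in e].
have wP (e : {set _}) : (0 < #|e|)%N -> w e \in e.
  by rewrite card_gt0 /w => /set0Pn[v ve]; case: pickP => //= /(_ v); rewrite ve.
(* Only the rule without one point must be sampled; its size [k = q - 1] is the exponent in the
   threshold on [c]. *)
pose s i := [seq e :\ w e | e <- enum (E i)].
have sub_EM i e : e \in E i -> e \in M i by rewrite inE => /andP[].
have card_M i e : e \in M i -> #|e| = k.+1 by case: (MP i) => _ _ + _; apply.
have [|i _|i iB|i|A cA badA] := sparse_sampling_set _ _ c k (B :\: heavy) s.
- by rewrite card_ord.
- rewrite pairwise_map; have := enum_uniq (E i); rewrite uniq_pairwise.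
  apply: (sub_in_pairwise (P := [in E i])) => [e e' eE e'E /= nee'|]; last first.
    by apply/allP => e; rewrite mem_enum.
  have [_ /trivIsetP trM _ _] := MP i.
  have := trM _ _ (sub_EM _ _ eE) (sub_EM _ _ e'E) nee'.
  by apply: disjointW; apply: subsetDl.
- apply/allP => _ /mapP[e + ->]; rewrite mem_enum => /sub_EM/card_M ek.
  by have := cardsD1 (w e) e; rewrite wP ek // => -[->].
- by rewrite inE => /andP[/card_E + _]; rewrite size_map -cardE.
pose T' := T :|: heavy :|: A.
have sTT' : T \subset T' by rewrite /T' -setUA subsetUl.
have sub_spanT' (X : {set 'I_n}) : X \subset T' -> X \subset Defs.span S T'.
  by move=> sX; exact: (subset_trans sX (span_extensive S T')).
have span_add x y z : x \in Defs.span S (y |: T') -> z \in Defs.span S (x |: T') ->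
    z \in Defs.span S (y |: T').
  move=> xy; apply/subsetP/span_subset; rewrite subUset sub1set xy.
  exact: subset_trans (subsetUr _ _) (span_extensive _ _).
have span_absorb x z : x \in Defs.span S T' -> z \in Defs.span S (x |: T') ->
    z \in Defs.span S T'.
  move=> xT; apply/subsetP/span_subset; rewrite subUset sub1set xT.
  exact: span_extensive.
have span_g v : v \in Defs.span S (g v |: T').
  by apply: subsetP (gP v).2; apply/spanS/setUS.
(* Points already spanned by [T'] are dropped first, as they need no dominator. *)
have [|j i l|B' sB' [domB' cB']] := min_dominating_card _
    (fun j i => i \in Defs.span S (j |: T')) (B :\: Defs.span S T').
- by move=> i; apply: (subsetP (span_extensive S _)); rewrite setU11.
- exact: span_add.
exists T', B'; split.
- move=> v; have [gT|gT] := boolP (g v \in Defs.span S T').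
    by left; apply: span_absorb gT (span_g v).
  have [|b bB' gb] := domB' (g v); first by rewrite in_setD gT (gP v).1.
  by right; exists b => //; apply: span_add gb (span_g v).
- set bad0 := [set i in _ | _] in cB'; set bad := [set i in _ | _] in badA.
  have : bad0 \subset bad.
    apply/subsetP => i; rewrite in_set in_setD => /andP[/andP[iT iB] noj].
    have iheavy : i \notin heavy.
      have sheavy : heavy \subset T' by rewrite /T' setUAC subsetUr.
      by apply: contra iT => ih; exact: (subsetP (sub_spanT' heavy sheavy) i ih).
    rewrite in_set in_setD iheavy iB /=.
    apply/allP => _ /mapP[e + ->]; rewrite mem_enum => eE.
    apply: contra noj => eA; have eM := sub_EM _ _ eE.
    have we : w e \in e by apply: wP; rewrite (card_M i e eM).
    have ij : i \in Defs.span S (g (w e) |: T').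
      have [_ _ _ rules] := MP i; apply: span_rule (rules e eM) _.
      apply/subsetP=> v ve; have [->|nv] := eqVneq v (w e); first exact: span_g.
      apply: (subsetP (span_extensive S _)); rewrite !inE (subsetP eA) ?orbT //.
      by rewrite !inE nv.
    (* Otherwise [i] would be spanned by [T'] alone; so [g (w e)] is still among the points to be
       dominated and witnesses that [i] is not minimal. *)
    have gT : g (w e) \notin Defs.span S T'.
      by apply: contra iT => gT; apply: span_absorb ij.
    apply/exists_inP; exists (g (w e)); first by rewrite in_setD gT (gP _).1.
    rewrite ij andbT; move: eE; rewrite inE => /andP[_ /forall_inP]; exact.
  move/subset_leq_card => c1.
  have c2 : (#|B :\: Defs.span S T'| <= #|B|)%N by rewrite subset_leq_card ?subsetDl.
  have c3 : (#|B :\: heavy| <= #|B|)%N by rewrite subset_leq_card ?subsetDl.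
  lia.
- have : (#|T'| <= #|T| + #|heavy| + #|A|)%N.
    apply: leq_trans (leq_card_setU _ _) _; rewrite leq_add2r.
    exact: leq_card_setU.
  rewrite -(ler_nat R) !natrD => /le_trans; apply; rewrite -addrA lerD2l.
  apply: lerD => //; rewrite ler_pdivlMr ?ltr0n // mulrC -!natrM ler_nat.
  by rewrite card_ord in cA.
Qed.

(** * Iterating the rounds *)

Lemma dominates_card_decay (R : realType) (k n c : nat) (delta : R) (S : spanoid n)
    (m : nat) :
  (0 < n)%N -> 0 < delta -> is_LCS k.+1 delta S ->
  (c.+1 ^ k)%:R <= delta * n%:R ->
  exists T B : {set 'I_n}, [/\ dominates S T B,
    #|B|%:R <= (11 / 12) ^+ m * n%:R :> R &
    #|T|%:R <= m%:R * (2 / delta + 5 * n%:R / c.+1%:R)].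
Proof.
move=> n0 d0 lcs ck; elim: m => [|m [T [B [dom cB cT]]]].
  exists set0, setT; split; last by rewrite cards0 mul0r.
    move=> v; right; exists v; rewrite ?in_setT //.
    by apply: (subsetP (span_extensive S _)); rewrite setU11.
  by rewrite cardsT card_ord expr0 mul1r.
have [T' [B' [dom' cB' cT']]] := dominates_refine _ _ _ _ _ _ _ _ n0 d0 lcs ck dom.
exists T', B'; split=> //; last first.
  by apply: le_trans cT' _; rewrite -(natr1 m) [leRHS]mulrDl mul1r lerD2r.
have : (12 * #|B'|)%:R <= (11 * #|B|)%:R :> R by rewrite ler_nat.
by rewrite !natrM exprSr; lra.
Qed.

(** Eight rounds at least halve the bound on [B], and [t] halvings bring [n] below 1. *)
Lemma rank_le_sampling (R : realType) (k n c : nat) (delta : R) (S : spanoid n) :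
  (0 < n)%N -> 0 < delta -> is_LCS k.+1 delta S ->
  (c.+1 ^ k)%:R <= delta * n%:R ->
  (rank S)%:R <= (8 * (trunc_log 2 n).+1)%:R * (2 / delta + 5 * n%:R / c.+1%:R).
Proof.
move=> n0 d0 lcs ck; set t := (trunc_log 2 n).+1.
have [T [B [dom cB cT]]] := dominates_card_decay _ _ _ _ _ _ (8 * t) n0 d0 lcs ck.
(* With [B] empty only the first alternative of [dominates] survives, so [T] spans everything. *)
suff B0 : B = set0.
  apply: le_trans cT; rewrite ler_nat; apply: rank_le; apply/setP => v.
  by rewrite in_setT; case: (dom v) => [->|[b]] //; rewrite B0 in_set0.
apply/eqP; rewrite -cards_eq0 -leqn0 -ltnS -(ltr_nat R); apply: le_lt_trans cB _.
have half : (11 / 12) ^+ 8 <= 2^-1 :> R.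
  have sq (x y : R) : 0 <= x -> x <= y -> x ^+ 2 <= y ^+ 2.
    by move=> x0 xy; rewrite lerXn2r // nnegrE // (le_trans x0).
  rewrite (_ : 8 = 2 * 2 * 2)%N // !exprM.
  (* A rational slightly above [121/144] whose fourth power is still below [1/2]. *)
  have h1 : (11 / 12) ^+ 2 <= 8403 / 10000 :> R by lra.
  have h2 := sq _ _ (sqr_ge0 _) h1.
  have h3 := sq _ _ (sqr_ge0 _) h2.
  apply: le_trans h3 _; lra.
rewrite exprM; apply: le_lt_trans (_ : 2^-1 ^+ t * n%:R < _).
  by rewrite ler_wpM2r // lerXn2r // nnegrE ?exprn_ge0 //; lra.
rewrite exprVn mulrC ltr_pdivrMr ?exprn_gt0 // mul1r -natrX ltr_nat.
exact: trunc_log_ltn.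
Qed.

(** * Logarithm estimates and the final bound *)

Lemma log2_ge1 (R : realType) (n : nat) : (2 <= n)%N -> 1 <= log2 (n%:R : R).
Proof.
move=> n2; have ln2 : 0 < ln 2 :> R by rewrite ln_gt0 // ltr1n.
rewrite /log2 ler_pdivlMr // mul1r ler_ln ?posrE ?ltr0n ?ler_nat //.
exact: leq_trans n2.
Qed.

Lemma trunc_log2_le (R : realType) (n : nat) :
  (0 < n)%N -> (trunc_log 2 n)%:R <= log2 (n%:R : R).
Proof.
move=> n0; have ln2 : 0 < ln 2 :> R by rewrite ln_gt0 // ltr1n.
rewrite /log2 ler_pdivlMr // mulr_natl -lnXn // -natrX.
by rewrite ler_ln ?posrE ?ltr0n ?expn_gt0 // ler_nat trunc_logP.
Qed.

Theorem mainTheorem2 (R : realType) (q : nat) (hq : (3 <= q)%N) :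
  exists C : R, 0 < C /\
    forall (n : nat) (delta : R) (S : spanoid n),
      (2 <= n)%N -> 0 < delta -> is_LCS q delta S ->
      (rank S)%:R <=
        C * delta `^ (- (1 / (q%:R - 1)))
          * n%:R `^ ((q%:R - 2) / (q%:R - 1)) * log2 n%:R.
Proof.
(* Here [192 = 16 * 12]: at most [16 * log2 n] rounds, each costing at most [(2 + 10) * n / y]. *)
case: q hq => // k; rewrite ltnS => k2; exists 192; split=> // n delta S n2 d0 lcs.
have n0 : (0 < n)%N by apply: leq_trans n2.
have n0R : 0 < n%:R :> R by rewrite ltr0n.
have k0R : 0 < k%:R :> R by rewrite ltr0n; apply: ltnW.
have -> : k.+1%:R - 1 = k%:R :> R by rewrite -addn1 natrD addrK.
pose y := (delta * n%:R) `^ (1 / k%:R).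
have y0 : 0 < y by rewrite powR_gt0 // mulr_gt0.
have -> : 192 * delta `^ (- (1 / k%:R)) * n%:R `^ ((k.+1%:R - 2) / k%:R) =
    192 * (n%:R / y).
  have -> : (k.+1%:R - 2) / k%:R = 1 - 1 / k%:R :> R.
    by rewrite -addn1 natrD; field; rewrite gt_eqF.
  rewrite powRB ?lt0r_neq0 ?implybT // powRr1 ?ltW // powRN /y powRM ?ltW //.
  by rewrite invfM; ring.
have log1 := log2_ge1 R n n2.
have ny0 : 0 < n%:R / y by rewrite divr_gt0.
(* For [y < 1] no positive integer lies below [y], but the trivial bound [n <= n / y] suffices. *)
have [y1|y1] := ltP y 1.
  apply: le_trans (_ : n%:R <= _).
    by rewrite ler_nat -[leqRHS]card_ord -cardsT; apply/rank_le/span_setT.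
  apply: le_trans (_ : n%:R / y <= _).
    by rewrite ler_pdivlMr // ler_piMr // ltW.
  have : n%:R / y * 1 <= n%:R / y * log2 n%:R by rewrite ler_pM2l.
  lra.
have yk : y ^+ k = delta * n%:R.
  rewrite -powR_mulrn ?ltW // /y -powRrM div1r mulVf ?gt_eqF // powRr1 //.
  by rewrite ltW // mulr_gt0.
have /andP[cy yc] := truncn_itv (ltW y0).
have c0 : (0 < Num.truncn y)%N.
  by rewrite -ltnS -(ltr_nat R); apply: le_lt_trans yc.
(* The integer part of [y] is written [c.+1], giving [c + 1 <= y < c + 2 <= 2 * (c + 1)]; the last
   bound costs the factor 2 in [sample_le]. *)
move: (Num.truncn y) c0 cy yc => [//|c] _ cy yc.
have ck : (c.+1 ^ k)%:R <= delta * n%:R.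
  by rewrite -yk natrX lerXn2r // nnegrE ltW.
apply: le_trans (rank_le_sampling _ _ _ _ _ _ n0 d0 lcs ck) _.
(* From [y >= 1] follows [y <= y ^+ k = delta * n]. *)
have heavy_le : 2 / delta <= 2 * (n%:R / y).
  have : y <= delta * n%:R.
    by rewrite -yk; apply: ler_eXnr => //; apply: ltnW.
  rewrite mulrA ler_pdivlMr // mulrAC ler_pdivrMr //; nra.
have sample_le : 5 * n%:R / c.+1%:R <= 10 * (n%:R / y).
  have c1 : 1 <= c.+1%:R :> R by rewrite ler1n.
  have : y <= 2 * c.+1%:R by move: yc; rewrite -[c.+2]addn1 natrD; lra.
  move=> yc2; rewrite mulrA ler_pdivlMr // mulrAC ler_pdivrMr ?ltr0n //; nra.
have rounds_le : (8 * (trunc_log 2 n).+1)%:R <= 16 * log2 n%:R :> R.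
  have := trunc_log2_le R n n0; rewrite natrM -natr1; lra.
rewrite (_ : 192 * _ * _ = 16 * log2 n%:R * (12 * (n%:R / y))); last by ring.
apply: ler_pM => //; last first.
  rewrite (_ : 12 * _ = 2 * (n%:R / y) + 10 * (n%:R / y)); last by ring.
  exact: lerD.
by rewrite addr_ge0 // divr_ge0 // ?mulr_ge0 // ltW.
Qed.
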